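(* Let $n\ge2$, let $V_1,\dots,V_m$ be complex $n\times n$ matrices with $\sum_{i=1}^mV_i^*V_i=I_n$, and define on the space $S_n$ of $n\times n$ Hermitian matrices $\Phi(X)=\sum_{i=1}^mV_i^*XV_i$ and its dual $\Psi(X)=\sum_{i=1}^mV_iXV_i^*$. Then $$\|\Phi\|_H=\|\Psi\|_H^\star=1-\min_{\substack{u,v\in\mathbb{C}^n:\ u^*v=0\\ u^*u=v^*v=1}}\ \min_{\substack{X=(x_1,\dots,x_n)\\ XX^*=I_n}}\ \sum_{i=1}^n\min\{u^*\Phi(x_ix_i^* )u,\ v^*\Phi(x_ix_i^* )v\},$$ where the second minimum is over all complex unitary matrices $X$ with columns $x_1,\dots,x_n$.
   Context: $S_n$ is a real vector space; $\lambda_{\max},\lambda_{\min}$ are the largest and smallest eigenvalues. The contraction ratio for the diameter of the spectrum (operator norm induced by Hopf's oscillation seminorm) is $$\|\Phi\|_H=\sup_{X\in S_n,\ \lambda_{\max}(X)\ne\lambda_{\min}(X)}\frac{\lambda_{\max}(\Phi(X))-\lambda_{\min}(\Phi(X))}{\lambda_{\max}(X)-\lambda_{\min}(X)},$$ and the contraction ratio of the trace distance on density matrices is $$\|\Psi\|_H^\star=\sup_{\rho_1\neq\rho_2}\frac{\|\Psi(\rho_1)-\Psi(\rho_2)\|_1}{\|\rho_1-\rho_2\|_1},$$ where $\rho_1,\rho_2$ range over positive semidefinite Hermitian matrices of trace $1$ and $\|\cdot\|_1$ is the trace norm (sum of absolute values of the eigenvalues). *)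

(* Defs.v *)
From HB Require Import structures.
From mathcomp Require Import all_boot all_order all_algebra.
From mathcomp Require Import classical_sets reals constructive_ereal ereal.
From mathcomp Require Import complex.

Set Implicit Arguments.
Unset Strict Implicit.
Unset Printing Implicit Defensive.

Import Order.TTheory GRing.Theory Num.Theory.

Local Open Scope classical_set_scope.
Local Open Scope ring_scope.
Local Open Scope complex_scope.
Local Open Scope sesquilinear_scope.

Definition is_minimum (R : realType) (A : set R) (m : R) : Prop :=
  A m /\ lbound A m.

Section Spectrum.
Variables (R : realType) (n : nat).
Implicit Types A : 'M[R[i]]_n.

(* For Hermitian A and 0 < n the set of eigenvalues is real, finite and
   nonempty, so that sup and inf are its largest and smallest elements. *)
Definition real_eigenvalues A : set R := [set x : R | eigenvalue A x%:C].

Definition lambda_max A : R := sup (real_eigenvalues A).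

Definition lambda_min A : R := inf (real_eigenvalues A).

(* Eigenvalues repeated according to their algebraic multiplicity. *)
Definition spectrum_seq A : seq R[i] :=
  sval (closed_field_poly_normal (char_poly A)).

(* The trace norm of a Hermitian matrix; for other matrices the singular values
   would be needed instead of the eigenvalues. *)
Definition trace_norm A : R := \sum_(z <- spectrum_seq A) complex.Re `|z|.

(* u^* A u, which is real when A is Hermitian. *)
Definition qform A (u : 'cV[R[i]]_n) : R :=
  complex.Re ((u ^t* *m A *m u) 0 0).

(* The order of R[i] makes 0 <= z imply that z is real. *)
Definition psdmx A : Prop :=
  A \is hermsymmx /\ forall u : 'cV[R[i]]_n, 0 <= (u ^t* *m A *m u) 0 0.

Definition density_matrix A : Prop := psdmx A /\ \tr A = 1.

End Spectrum.

Section Contraction.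
Variables (R : realType) (n : nat).

(* The suprema are taken in \bar R, hence involve no default value for
   unbounded sets. *)
Definition hopf_norm (Phi : 'M[R[i]]_n -> 'M[R[i]]_n) : \bar R :=
  ereal_sup [set ((lambda_max (Phi X) - lambda_min (Phi X))
                    / (lambda_max X - lambda_min X))%:E
            | X in [set X : 'M[R[i]]_n |
                      X \is hermsymmx /\ lambda_max X <> lambda_min X]].

Definition trace_contraction (Psi : 'M[R[i]]_n -> 'M[R[i]]_n) : \bar R :=
  ereal_sup [set (trace_norm (Psi r.1 - Psi r.2) / trace_norm (r.1 - r.2))%:E
            | r in [set r : 'M[R[i]]_n * 'M[R[i]]_n |
                      [/\ density_matrix r.1, density_matrix r.2
                        & r.1 <> r.2]]].

End Contraction.

Section KrausMaps.
Variables (R : realType) (n m : nat) (V : 'I_m -> 'M[R[i]]_n).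

Definition kraus_unital (X : 'M[R[i]]_n) : 'M[R[i]]_n :=
  \sum_(i < m) (V i) ^t* *m X *m V i.

Definition kraus_dual (X : 'M[R[i]]_n) : 'M[R[i]]_n :=
  \sum_(i < m) V i *m X *m (V i) ^t*.

End KrausMaps.

Definition orthonormal_pair (R : realType) (n : nat) (u v : 'cV[R[i]]_n) : Prop :=
  [/\ u ^t* *m v = 0, u ^t* *m u = 1%:M & v ^t* *m v = 1%:M].

Definition overlap (R : realType) (n : nat) (Phi : 'M[R[i]]_n -> 'M[R[i]]_n)
    (u v : 'cV[R[i]]_n) (X : 'M[R[i]]_n) : R :=
  \sum_(i < n) Num.min (qform (Phi (col i X *m (col i X) ^t*)) u)
                       (qform (Phi (col i X *m (col i X) ^t*)) v).

(* Main.v *)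
Require Import Defs.
From HB Require Import structures.
From mathcomp Require Import all_boot all_order all_algebra.
From mathcomp Require Import classical_sets reals constructive_ereal ereal.
From mathcomp Require Import complex.
From mathcomp Require Import boolp topology normedtype derive.
From mathcomp Require Import ring lra.

Set Implicit Arguments.
Unset Strict Implicit.
Unset Printing Implicit Defensive.

Import Order.TTheory GRing.Theory Num.Theory.
Import numFieldNormedType.Exports.

Local Open Scope classical_set_scope.
Local Open Scope ring_scope.
Local Open Scope complex_scope.
Local Open Scope sesquilinear_scope.

(** Write P(u) = u u^* for the rank-one projection on a unit vector u, T for the
    trace norm, and M for the maximum of T(Psi(P(u) - P(v))) over orthonormal
    pairs (u, v).  All three quantities of the theorem are equal to M / 2.

    The minimum over unitary matrices.  The map Psi is the adjoint of Phi for
    the pairing (X, A) |-> Re tr(X A), so that u^* Phi(P(x)) u is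
    x^* Psi(P(u)) x.  As min(a, b) = (a + b - |a - b|) / 2 and Psi preserves
    the trace, the sum attached to u, v and X is
    1 - 1/2 \sum_i |x_i^* A x_i| with A = Psi(P(u) - P(v)).  The diagonal of a
    Hermitian matrix A in an orthonormal basis is obtained from its spectrum by a
    doubly stochastic matrix, hence \sum_i |x_i^* A x_i| <= T(A), with equality in
    an eigenbasis ([pinching], [pinching_eq]).  The inner minimum is thus
    1 - T(A) / 2 ([overlap_minimum]).  The outer one is attained because the sum
    depends continuously on (u, v, X), which ranges over a compact set
    ([pure_distance_max]).

    The trace distance.  A difference D of density matrices is Hermitian and
    traceless, so that it has a spectral decomposition whose positive and
    negative parts have the same mass t = T(D) / 2; coupling them independently
    writes t D as a combination of differences P(y_i) - P(y_j) of orthogonal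
    eigenprojections with nonnegative weights of sum t^2.  Convexity of T gives
    T(Psi D) <= t M ([trace_norm_adjoint_le]), and a maximizing pair of pure
    states, at distance 2, attains the ratio M / 2.

    The diameter of the spectrum.  For unit eigenvectors u and v of Phi(X) with
    extreme eigenvalues, the diameter of the spectrum of Phi(X) is
    tr(X A), and since A is traceless, X may be replaced by X - c with c the
    midpoint of its spectrum; so tr(X A) is at most half the diameter of the
    spectrum of X times T(A) ([spread_le]).  Conversely, for a maximizing
    pair, taking for X the sign of A in an eigenbasis of A makes tr(X A) equal to
    T(A), while X has diameter 2 ([spread_ge]). *)

(** * Real parts and adjoints *)

Section RealPart.
Variable R : realType.
Implicit Types z w : R[i].

Lemma Re_add z w : complex.Re (z + w) = complex.Re z + complex.Re w.
Proof. by case: z w => [a b] [c d]. Qed.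

Lemma Re_sub z w : complex.Re (z - w) = complex.Re z - complex.Re w.
Proof. by case: z w => [a b] [c d]. Qed.

Lemma Re_scale (a : R) z : complex.Re (a%:C * z) = a * complex.Re z.
Proof. by case: z => [b c] /=; rewrite mul0r subr0. Qed.

Lemma Re_sum (I : finType) (F : I -> R[i]) :
  complex.Re (\sum_i F i) = \sum_i complex.Re (F i).
Proof. by apply: (big_morph (@complex.Re R)) => //; exact: Re_add. Qed.

Lemma conjC_pair (a b : R) : Num.conj (a +i* b) = a -i* b.
Proof. by []. Qed.

Lemma conjC_re (a : R) : Num.conj a%:C = a%:C.
Proof. by rewrite conjC_pair oppr0. Qed.

Lemma Re_norm_re (a : R) : complex.Re `|a%:C| = `|a|.
Proof. by rewrite normc_def /= expr0n addr0 sqrtr_sqr. Qed.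

Lemma Re_norm_ge0 z : 0 <= complex.Re `|z|.
Proof. by have := normr_ge0 z; rewrite lecE => /andP[]. Qed.

End RealPart.

Section ConjugateTranspose.
Variable C : numClosedFieldType.

Lemma trmxC_mul m n p (A : 'M[C]_(m, n)) (B : 'M[C]_(n, p)) :
  (A *m B) ^t* = B ^t* *m A ^t*.
Proof. by rewrite trmx_mul map_mxM. Qed.

Lemma trmxC_sum m n (I : finType) (A : I -> 'M[C]_(m, n)) :
  (\sum_i A i) ^t* = \sum_i (A i) ^t*.
Proof. by rewrite !raddf_sum. Qed.

Lemma trmxC_sub m n (A B : 'M[C]_(m, n)) : (A - B) ^t* = A ^t* - B ^t*.
Proof. by rewrite !raddfB. Qed.

Lemma hermsymP n (A : 'M[C]_n) : A \is hermsymmx <-> A ^t* = A.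
Proof.
split=> [/is_hermitianmxP|hA]; rewrite ?expr0 ?scale1r //.
by apply/is_hermitianmxP; rewrite expr0 scale1r.
Qed.

End ConjugateTranspose.

(** * Hermitian forms and rank-one projections *)

(** The pairing (A, B) |-> rtr (A *m B) is the real inner product on Hermitian
    matrices for which the two maps of the theorem are adjoint.  This function
    and the next two are sealed because comparing two of their values by
    conversion would unfold the arithmetic of the matrix entries. *)
HB.lock Definition rtr (R : realType) n (A : 'M[R[i]]_n) : R :=
  complex.Re (\tr A).

HB.lock Definition ketbra (R : realType) n (u : 'cV[R[i]]_n) : 'M[R[i]]_n :=
  u *m u ^t*.

HB.lock Definition expval (R : realType) n (A : 'M[R[i]]_n) (u : 'cV[R[i]]_n)
    : R := qform A u.

Section RankOne.
Variables (R : realType) (n : nat).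
Local Notation C := R[i].
Implicit Types (A B U X : 'M[C]_n) (u v x y : 'cV[C]_n).

(** The columns of U are the eigenvectors, so that a spectral decomposition is a
    real combination of projections, on which linear maps act termwise. *)
Definition spectral_sum U (d : 'I_n -> R) : 'M[C]_n :=
  \sum_i (d i)%:C *: ketbra (col i U).

Lemma rtr_mulC A B : rtr (A *m B) = rtr (B *m A).
Proof. by rewrite !rtr.unlock mxtrace_mulC. Qed.

Lemma rtr_sum (I : finType) (F : I -> 'M[C]_n) :
  rtr (\sum_i F i) = \sum_i rtr (F i).
Proof. by rewrite !rtr.unlock [\tr _]raddf_sum Re_sum. Qed.

Lemma rtrB A B : rtr (A - B) = rtr A - rtr B.
Proof. by rewrite !rtr.unlock [\tr _]raddfB Re_sub. Qed.

Lemma rtrZ (a : R) A : rtr (a%:C *: A) = a * rtr A.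
Proof. by rewrite !rtr.unlock mxtraceZ Re_scale. Qed.

Lemma expval_qform A u : expval A u = qform A u.
Proof. by rewrite expval.unlock. Qed.

Lemma ketbraE u : ketbra u = u *m u ^t*.
Proof. by rewrite ketbra.unlock. Qed.

Lemma expvalE A u : expval A u = rtr (A *m ketbra u).
Proof.
rewrite expval.unlock rtr.unlock ketbra.unlock /qform.
rewrite mulmxA mxtrace_mulC mulmxA /mxtrace.
by rewrite big_ord1.
Qed.

Lemma ketbra_herm u : (ketbra u) ^t* = ketbra u.
Proof. by rewrite ketbra.unlock trmxC_mul trmxCK. Qed.

Lemma rtr_ketbra u : rtr (ketbra u) = complex.Re ((u ^t* *m u) 0 0).
Proof. by rewrite rtr.unlock ketbra.unlock mxtrace_mulC /mxtrace big_ord1. Qed.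

Lemma rtr_ketbra_unit u : u ^t* *m u = 1%:M -> rtr (ketbra u) = 1.
Proof. by move=> h; rewrite rtr_ketbra h mxE. Qed.

Lemma ketbra_form_ge0 u v : 0 <= (v ^t* *m ketbra u *m v) 0 0.
Proof.
have -> : v ^t* *m ketbra u *m v = (u ^t* *m v) ^t* *m (u ^t* *m v).
  by rewrite trmxC_mul trmxCK ketbra.unlock !mulmxA.
rewrite mxE big_ord1 [_ ^t* _ _]mxE [_ ^T _ _]mxE mulrC.
exact: mul_conjC_ge0.
Qed.

Lemma expval_ketbra_ge0 u v : 0 <= expval (ketbra u) v.
Proof.
by have := ketbra_form_ge0 u v; rewrite expval.unlock lecE => /andP[]. Qed.

Lemma expval_ketbraC u v : expval (ketbra u) v = expval (ketbra v) u.
Proof. by rewrite !expvalE rtr_mulC. Qed.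

Lemma expval_sum (I : finType) (c : I -> R) (F : I -> 'M[C]_n) x :
  expval (\sum_i (c i)%:C *: F i) x = \sum_i c i * expval (F i) x.
Proof.
rewrite expvalE mulmx_suml rtr_sum; apply: eq_bigr => i _.
by rewrite -scalemxAl rtrZ expvalE.
Qed.

Lemma expvalB A B x : expval (A - B) x = expval A x - expval B x.
Proof. by rewrite !expvalE mulmxBl rtrB. Qed.

Lemma sum_ketbra_unitary U :
  U \is unitarymx -> \sum_i ketbra (col i U) = 1%:M.
Proof.
move=> /unitarymxP <-; apply/matrixP => i j; rewrite summxE !mxE.
by apply: eq_bigr => k _; rewrite ketbra.unlock !mxE big_ord1 !mxE.
Qed.

Lemma col_unitary U i j :
  U \is unitarymx -> (col i U) ^t* *m col j U = (i == j)%:R%:M.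
Proof.
rewrite -trmxC_unitary => /unitarymxP; rewrite trmxCK => /matrixP /(_ i j).
rewrite !mxE => <-; apply/matrixP => a b; rewrite !mxE !ord1 eqxx mulr1n.
by apply: eq_bigr => k _; rewrite !mxE.
Qed.

Lemma sum_expval_unitary A U :
  U \is unitarymx -> \sum_i expval A (col i U) = rtr A.
Proof.
move=> hU; under eq_bigr do rewrite expvalE.
by rewrite -rtr_sum -mulmx_sumr sum_ketbra_unitary // mulmx1.
Qed.

(** Together with [sum_expval_unitary], this makes the matrix of the overlaps
    |u_i^* x_j|^2 of two orthonormal bases doubly stochastic. *)
Lemma sum_weight_unitary U x : U \is unitarymx -> x ^t* *m x = 1%:M ->
  \sum_i expval (ketbra (col i U)) x = 1.
Proof.
move=> hU hx; under eq_bigr do rewrite expval_ketbraC.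
by rewrite sum_expval_unitary // rtr_ketbra_unit.
Qed.

Lemma expval_spectral U d x :
  expval (spectral_sum U d) x = \sum_i d i * expval (ketbra (col i U)) x.
Proof. exact: expval_sum. Qed.

Lemma expval_spectral_col U d i : U \is unitarymx ->
  expval (spectral_sum U d) (col i U) = d i.
Proof.
move=> hU; rewrite expval_spectral (bigD1 i) //= big1 ?addr0 => [|j ji].
  rewrite expval.unlock ketbra.unlock /qform mulmxA col_unitary // eqxx.
  rewrite mul1mx col_unitary //.
  by rewrite eqxx mxE mulr1.
rewrite expval.unlock ketbra.unlock /qform mulmxA col_unitary // eq_sym.
rewrite (negbTE ji).
by rewrite mul_scalar_mx scale0r mul0mx mxE mulr0.
Qed.

Lemma rtr_spectral U d : U \is unitarymx -> rtr (spectral_sum U d) = \sum_i d i.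
Proof.
move=> hU; rewrite rtr_sum; apply: eq_bigr => i _.
by rewrite rtrZ rtr_ketbra_unit ?mulr1 // col_unitary // eqxx.
Qed.

Lemma spectral_sumE U d :
  spectral_sum U d = U *m diag_mx (\row_i (d i)%:C) *m U ^t*.
Proof.
apply/matrixP => i j; rewrite summxE mxE; apply: eq_bigr => k _.
rewrite mul_mx_diag ketbra.unlock !mxE big_ord1 !mxE; ring.
Qed.

Lemma spectral_sum_herm U d : (spectral_sum U d) ^t* = spectral_sum U d.
Proof.
rewrite /spectral_sum trmxC_sum; apply: eq_bigr => i _.
by rewrite linearZ /= map_mxZ ketbra_herm; congr (_ *: _); exact: conjC_re.
Qed.

(** * Spectra, trace norm and spread of Hermitian matrices *)

Lemma spectral_theorem A : A ^t* = A ->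
  exists U d, U \is unitarymx /\ A = spectral_sum U d.
Proof.
move=> /hermsymP hA.
have /hermitian_normalmx/orthomx_spectralP eA := hA.
exists ((spectralmx A) ^t*), (fun i => complex.Re (spectral_diag A 0 i)).
split; first by rewrite trmxC_unitary spectral_unitarymx.
rewrite spectral_sumE trmxCK -(invmx_unitary (spectral_unitarymx A)).
apply: etrans eA _; congr (_ *m diag_mx _ *m _).
apply/rowP => i; rewrite mxE RRe_real //.
exact: (mxOverP (hermitian_spectral_diag_real hA)).
Qed.

(** Conjugation by the constant matrix U reduces the characteristic matrix to that
    of the diagonal matrix of the eigenvalues. *)
Lemma char_poly_spectral U d : U \is unitarymx ->
  char_poly (spectral_sum U d) = \prod_i ('X - ((d i)%:C)%:P).
Proof.
move=> hU; set D : 'M[C]_n := diag_mx (\row_i (d i)%:C).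
have UP : map_mx polyC U *m map_mx polyC (U ^t*) = 1%:M.
  by rewrite -map_mxM (unitarymxP hU) map_mx1.
transitivity (char_poly D); last first.
  rewrite char_poly_trig; last exact: diag_mx_is_trig.
  by apply: eq_bigr => i _; rewrite !mxE eqxx.
have -> : char_poly (spectral_sum U d)
        = \det (map_mx polyC U *m char_poly_mx D *m map_mx polyC (U ^t*)).
  rewrite /char_poly /char_poly_mx spectral_sumE !map_mxM.
  by rewrite mulmxBr mulmxBl scalar_mxC -['X%:M *m _ *m _]mulmxA UP mulmx1.
by rewrite !det_mulmx mulrAC -det_mulmx UP det1 mul1r.
Qed.

Lemma perm_spectrum U d : U \is unitarymx ->
  perm_eq (spectrum_seq (spectral_sum U d)) [seq (d i)%:C | i : 'I_n].
Proof.
move=> hU; apply: prod_XsubC_eq; rewrite big_image /= -(char_poly_spectral d hU).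
rewrite /spectrum_seq; case: closed_field_poly_normal => r /= ->.
by rewrite (monicP (char_poly_monic _)) scale1r.
Qed.

Lemma trace_norm_spectral U d : U \is unitarymx ->
  trace_norm (spectral_sum U d) = \sum_i `|d i|.
Proof.
move=> hU; rewrite /trace_norm (perm_big _ (perm_spectrum d hU)) big_image /=.
by apply: eq_bigr => i _; exact: Re_norm_re.
Qed.

Lemma real_eigenvalues_spectral U d : U \is unitarymx ->
  real_eigenvalues (spectral_sum U d) = range d.
Proof.
move=> hU; apply/seteqP; split=> x /=; rewrite /real_eigenvalues /=;
  rewrite eigenvalue_root_char char_poly_spectral // /root horner_prod.
  case/prodf_eq0 => i _; rewrite hornerXsubC subr_eq0 => /eqP [->].
  by exists i.
case=> i _ <-; apply/prodf_eq0; exists i => //.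
by rewrite hornerXsubC subrr.
Qed.

Lemma lambda_max_spectral U d i : U \is unitarymx ->
  (forall j, d j <= d i) -> lambda_max (spectral_sum U d) = d i.
Proof.
move=> hU hi; rewrite /lambda_max real_eigenvalues_spectral //.
apply/le_anti/andP; split.
  by apply: ge_sup => [|_ [j _ <-]]; [exists (d i), i|].
by apply: ub_le_sup; [exists (d i) => _ [j _ <-]|exists i].
Qed.

Lemma lambda_min_spectral U d i : U \is unitarymx ->
  (forall j, d i <= d j) -> lambda_min (spectral_sum U d) = d i.
Proof.
move=> hU hi; rewrite /lambda_min real_eigenvalues_spectral //.
apply/le_anti/andP; split; last first.
  by apply: lb_le_inf => [|_ [j _ <-]]; [exists (d i), i|].
by apply: ge_inf; [exists (d i) => _ [j _ <-]|exists i].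
Qed.

(** With A = \sum_i d_i P(u_i), each diagonal entry is the average of the d_i with
    weights |u_i^* x_j|^2; the triangle inequality and the summation over j, which
    makes the weights of each d_i sum to 1, give the bound. *)
Lemma pinching A X : A ^t* = A -> X \is unitarymx ->
  \sum_i `|expval A (col i X)| <= trace_norm A.
Proof.
move=> /spectral_theorem [U [d [hU ->]]] hX; rewrite trace_norm_spectral //.
pose w i j := expval (ketbra (col i U)) (col j X).
apply: (@le_trans _ _ (\sum_j \sum_i `|d i| * w i j)).
  apply: ler_sum => j _; rewrite expval_spectral.
  apply: le_trans (ler_norm_sum _ _ _) _; apply: ler_sum => i _.
  by rewrite normrM (ger0_norm (expval_ketbra_ge0 _ _)).
rewrite exchange_big /=; apply: ler_sum => i _.
rewrite -mulr_sumr sum_expval_unitary // rtr_ketbra_unit ?mulr1 //.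
by rewrite col_unitary // eqxx.
Qed.

(** Equality holds in an eigenbasis; the trace norm is thus a maximum of sums of
    absolute values of linear forms, which is what makes it convex. *)
Lemma pinching_eq A : A ^t* = A ->
  exists2 X : 'M[C]_n, X \is unitarymx &
    \sum_i `|expval A (col i X)| = trace_norm A.
Proof.
move=> /spectral_theorem [U [d [hU ->]]]; exists U => //.
rewrite trace_norm_spectral //; apply: eq_bigr => i _.
by rewrite expval_spectral_col.
Qed.

Lemma trace_norm_ge0 A : 0 <= trace_norm A.
Proof.
by apply: sumr_ge0 => z _; exact: Re_norm_ge0.
Qed.

Lemma trace_norm_gt0 A : A ^t* = A -> A <> 0 -> 0 < trace_norm A.
Proof.
move=> /spectral_theorem [U [d [hU ->]]] A0; rewrite lt_neqAle trace_norm_ge0.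
rewrite andbT eq_sym trace_norm_spectral //.
apply: contra_notN A0 => /eqP /psumr_eq0P d0.
rewrite /spectral_sum big1 // => i _.
have /eqP := d0 (fun i _ => normr_ge0 _) i isT; rewrite normr_eq0 => /eqP ->.
by rewrite scale0r.
Qed.

(** The value at a unit vector is an average of the eigenvalues. *)
Lemma expval_lambda A u : A ^t* = A -> u ^t* *m u = 1%:M ->
  lambda_min A <= expval A u <= lambda_max A.
Proof.
move=> /spectral_theorem [U [d [hU eA]]] hu.
have w1 := sum_weight_unitary hU hu.
have [i0 _|n0] := pickP (fun _ : 'I_n => true); last first.
  by move: w1; rewrite big_pred0 // => /esym/eqP; rewrite oner_eq0.
have [i _ hi] := arg_maxP d (isT : xpredT i0).
have [j _ hj] := arg_minP d (isT : xpredT i0).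
rewrite eA (lambda_max_spectral hU (fun k => hi k isT)).
rewrite (lambda_min_spectral hU (fun k => hj k isT)).
rewrite expval_spectral -[d i]mulr1 -[d j]mulr1 -w1 !mulr_sumr.
apply/andP; split; apply: ler_sum => k _; apply: ler_wpM2r;
  rewrite ?expval_ketbra_ge0 //; [exact: hj|exact: hi].
Qed.
End RankOne.

Section PureStates.
Variables (R : realType) (n : nat).
Local Notation C := R[i].
Implicit Types u v : 'cV[C]_n.

Lemma orthonormal_cols (U : 'M[C]_n) i j :
  U \is unitarymx -> i != j -> orthonormal_pair (col i U) (col j U).
Proof.
move=> hU ij; split; rewrite col_unitary ?eqxx //.
by rewrite (negbTE ij) raddf0.
Qed.

Lemma pure_diff_herm u v : (ketbra u - ketbra v) ^t* = ketbra u - ketbra v.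
Proof. by rewrite trmxC_sub !ketbra_herm. Qed.

Lemma trace_norm_pure_diff_le2 u v :
  orthonormal_pair u v -> trace_norm (ketbra u - ketbra v) <= 2.
Proof.
move=> [_ hu hv].
have [X hX <-] := pinching_eq (pure_diff_herm u v).
apply: (@le_trans _ _ (\sum_i (expval (ketbra u) (col i X)
                              + expval (ketbra v) (col i X)))); last first.
  rewrite big_split /= (sum_expval_unitary (ketbra u) hX).
  rewrite (sum_expval_unitary (ketbra v) hX).
  rewrite (rtr_ketbra_unit hu) (rtr_ketbra_unit hv); lra.
apply: ler_sum => i _; rewrite expvalB.
apply: le_trans (ler_normB _ _) _.
rewrite ger0_norm; last exact: expval_ketbra_ge0.
by rewrite ger0_norm; last exact: expval_ketbra_ge0.
Qed.

Lemma pure_diff_neq0 u v : orthonormal_pair u v -> ketbra u <> ketbra v.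
Proof.
move=> [uv hu _] /(congr1 (fun A => u ^t* *m A)).
rewrite ketbra.unlock !mulmxA uv hu mul0mx mul1mx => /(congr1 (mulmx^~ u)).
rewrite hu mul0mx => /matrixP /(_ 0 0) /eqP; rewrite !mxE eqxx.
by rewrite oner_eq0.
Qed.

End PureStates.

(** * Positive parts and signs of real vectors *)

Lemma jordan_parts (R : realDomainType) (x : R) :
  [/\ x = Num.max x 0 - Num.max (- x) 0,
      `|x| = Num.max x 0 + Num.max (- x) 0
    & Num.max x 0 * Num.max (- x) 0 = 0].
Proof.
have [x0|x0] := leP x 0; rewrite ?oppr_cp0.
  rewrite max_l ?oppr_ge0 // ler0_norm //.
  by split; rewrite ?sub0r ?opprK ?add0r ?mul0r.
rewrite max_r ?oppr_le0 ?ltW // gtr0_norm //.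
by split; rewrite ?subr0 ?addr0 ?mulr0.
Qed.

(** For a nonzero vector of sum zero, the signs of its entries take both values.
    For the zero vector every s satisfies the second clause, and s is chosen to
    take both values; this needs two indices. *)
Lemma sign_vector (R : realFieldType) n (d : 'I_n -> R) :
  (2 <= n)%N -> \sum_i d i = 0 ->
  exists s : 'I_n -> R,
    [/\ forall i, -1 <= s i <= 1, forall i, s i * d i = `|d i|,
        exists i, s i = 1 & exists j, s j = -1].
Proof.
move=> hn sd.
have [i di|dle] := pickP (fun i => 0 < d i).
  exists (fun i => if 0 < d i then 1 else -1); split.
  - by move=> k; case: ifP; lra.
  - move=> k; case: ltP => dk; first by rewrite gtr0_norm ?mul1r.
    by rewrite ler0_norm ?mulN1r.
  - by exists i; rewrite di.
  have [j dj|dge] := pickP (fun j => d j < 0).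
    by exists j; rewrite ltNge (ltW dj).
  have d0 : forall k, 0 <= d k by move=> k; rewrite leNgt dge.
  suff di0 : d i = 0 by rewrite di0 ltxx in di.
  exact: (psumr_eq0P (fun k _ => d0 k) sd).
have d0 k : d k = 0.
  have h : forall k, 0 <= - d k by move=> l; rewrite oppr_ge0 leNgt dle.
  have sN : \sum_i - d i = 0 by rewrite sumrN sd oppr0.
  apply/eqP; rewrite -oppr_eq0; apply/eqP.
  exact: (psumr_eq0P (fun k _ => h k) sN).
have n0 : (0 < n)%N by exact: ltnW.
exists (fun i => if i == Ordinal n0 then 1 else -1); split.
- by move=> k; case: ifP; lra.
- by move=> k; rewrite d0 mulr0 normr0.
- by exists (Ordinal n0); rewrite eqxx.
by exists (Ordinal hn).
Qed.

(** * Pairs of adjoint maps *)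

Section AdjointPair.
Variables (R : realType) (n : nat).
Local Notation C := R[i].
Variables (Phi : 'M[C]_n -> 'M[C]_n) (Psi : {linear 'M[C]_n -> 'M[C]_n}).
Implicit Types (A B U X : 'M[C]_n) (u v x y : 'cV[C]_n).

Hypothesis adjointP : forall X A, rtr (Phi X *m A) = rtr (X *m Psi A).
Hypothesis Phi1 : Phi 1%:M = 1%:M.
Hypothesis Phi_herm : forall X, X ^t* = X -> (Phi X) ^t* = Phi X.
Hypothesis Psi_herm : forall X, X ^t* = X -> (Psi X) ^t* = Psi X.

Lemma expval_adjoint x u : expval (Phi (ketbra x)) u = expval (Psi (ketbra u)) x.
Proof. by rewrite !expvalE adjointP rtr_mulC. Qed.

(** The distance between the images of two pure states; its maximum over
    orthonormal pairs is twice each of the contraction ratios. *)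
Definition pure_distance u v : R := trace_norm (Psi (ketbra u - ketbra v)).

Lemma pure_distance_ge0 u v : 0 <= pure_distance u v.
Proof. exact: trace_norm_ge0. Qed.

Lemma rtr_Psi A : rtr (Psi A) = rtr A.
Proof. by rewrite -[Psi A]mul1mx -adjointP Phi1 mul1mx. Qed.

(** This is min(a, b) = (a + b - |a - b|) / 2 summed over the columns of X, where
    the values of a, and those of b, have sum 1 because Psi preserves the trace. *)
Lemma overlapE u v X : orthonormal_pair u v -> X \is unitarymx ->
  overlap Phi u v X =
  1 - (\sum_i `|expval (Psi (ketbra u - ketbra v)) (col i X)|) / 2.
Proof.
move=> [_ hu hv] hX.
have s1 (w : 'cV[C]_n) : w ^t* *m w = 1%:M ->
    \sum_i expval (Psi (ketbra w)) (col i X) = 1.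
  by move=> hw; rewrite sum_expval_unitary // rtr_Psi rtr_ketbra_unit.
transitivity (\sum_i ((expval (Psi (ketbra u)) (col i X)
    + expval (Psi (ketbra v)) (col i X)
    - `|expval (Psi (ketbra u - ketbra v)) (col i X)|) / 2)).
  apply: eq_bigr => i _.
  rewrite -[qform _ u]expval_qform -[qform _ v]expval_qform -ketbraE.
  rewrite linearB expvalB -(expval_adjoint _ u) -(expval_adjoint _ v).
  by rewrite minr_absE.
rewrite -mulr_suml sumrB big_split /= !s1 //; lra.
Qed.

Lemma overlap_minimum u v : orthonormal_pair u v ->
  is_minimum [set overlap Phi u v X | X in [set X : 'M[C]_n | X \is unitarymx]]
    (1 - pure_distance u v / 2).
Proof.
move=> huv; have hA := Psi_herm (pure_diff_herm u v).
split.
  have [X hX eX] := pinching_eq hA.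
  by exists X => //; rewrite overlapE // eX.
move=> _ [X /= hX <-]; rewrite overlapE //.
have := pinching hA hX; rewrite -/(pure_distance u v); lra.
Qed.

Section Bound.
Variable M : R.
Hypothesis hM : forall u v, orthonormal_pair u v -> pure_distance u v <= M.

(** Write D = \sum_i (p_i - q_i) P_i with p and q the positive and negative parts
    of the spectrum, both of sum t since D is traceless.  Then
    t D = \sum_(i, j) p_i q_j (P_i - P_j), where the terms i = j vanish because
    p_i q_i = 0, and the other ones are controlled by M. *)
Lemma trace_norm_adjoint_le D : D ^t* = D -> D <> 0 -> rtr D = 0 ->
  trace_norm (Psi D) <= M / 2 * trace_norm D.
Proof.
move=> hD D0; have TD0 := trace_norm_gt0 hD D0.
have [X hX eX] := pinching_eq (Psi_herm hD).
have [U [d [hU eD]]] := spectral_theorem hD.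
rewrite eD rtr_spectral // -eD => sd0.
pose p i := Num.max (d i) 0; pose q i := Num.max (- d i) 0.
have p0 i : 0 <= p i by rewrite le_max lexx orbT.
have q0 i : 0 <= q i by rewrite le_max lexx orbT.
have dE i : d i = p i - q i by have [] := jordan_parts (d i).
have nE i : `|d i| = p i + q i by have [] := jordan_parts (d i).
have pq i : p i * q i = 0 by have [] := jordan_parts (d i).
pose t := \sum_i p i.
have tq : \sum_i q i = t.
  move: sd0; rewrite (eq_bigr _ (fun i _ => dE i)) sumrB => /eqP.
  by rewrite subr_eq0 => /eqP.
have TD : trace_norm D = 2 * t.
  rewrite eD trace_norm_spectral // (eq_bigr _ (fun i _ => nE i)) big_split /=.
  by rewrite tq -/t -mulr2n mulr_natl.
have t0 : 0 < t by rewrite -(pmulr_rgt0 t (ltr0Sn R 1)) -TD.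
pose P i := ketbra (col i U).
have key x : t * expval (Psi D) x
    = \sum_i \sum_j p i * q j * expval (Psi (P i - P j)) x.
  transitivity (t * \sum_i d i * expval (Psi (P i)) x).
    rewrite eD linear_sum /=; under eq_bigr do rewrite linearZ.
    by rewrite expval_sum.
  rewrite (eq_bigr (fun i => p i * expval (Psi (P i)) x
                           - q i * expval (Psi (P i)) x)); last first.
    by move=> i _; rewrite dE mulrBl.
  rewrite sumrB mulrBr -[in X in X - _]tq.
  under [RHS]eq_bigr => i _ do under eq_bigr => j _ do
    rewrite linearB expvalB mulrBr.
  under [RHS]eq_bigr => i _ do rewrite sumrB.
  rewrite sumrB; congr (_ - _).
    rewrite mulrC big_distrlr /=; apply: eq_bigr => i _; apply: eq_bigr => j _.
    ring.
  rewrite /t big_distrlr /=; apply: eq_bigr => i _; apply: eq_bigr => j _.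
  ring.
(* t is the common mass of p and q, so the total weight of the pairs is t^2. *)
suff : t * trace_norm (Psi D) <= t * (t * M).
  rewrite ler_pM2l // TD => h; apply: le_trans h _.
  by rewrite mulrA divfK ?pnatr_eq0 // mulrC.
rewrite -eX mulr_sumr.
apply: (@le_trans _ _ (\sum_k \sum_i \sum_j
    p i * q j * `|expval (Psi (P i - P j)) (col k X)|)).
  apply: ler_sum => k _; rewrite -{1}(gtr0_norm t0) -normrM key.
  apply: le_trans (ler_norm_sum _ _ _) _; apply: ler_sum => i _.
  apply: le_trans (ler_norm_sum _ _ _) _; apply: ler_sum => j _.
  by rewrite normrM ger0_norm // mulr_ge0.
rewrite exchange_big /= mulrA -{2}tq /t big_distrlr /= mulr_suml.
apply: ler_sum => i _; rewrite exchange_big /= mulr_suml.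
apply: ler_sum => j _; rewrite -mulr_sumr.
have [->|ij] := eqVneq i j; first by rewrite pq !mul0r.
apply: ler_wpM2l; first by rewrite mulr_ge0.
apply: le_trans (hM (orthonormal_cols hU ij)).
exact: pinching (Psi_herm (pure_diff_herm _ _)) hX.
Qed.

(** Evaluated at eigenvectors u and v of extreme eigenvalues, the spread of Phi(X)
    is tr(X A) with A = Psi(P(u) - P(v)).  In an eigenbasis of A this is
    \sum_k a_k (x_k - c) for any c, with a_k the eigenvalues of A and x_k the
    diagonal entries of X, as A is traceless; the midpoint c of the spectrum of X
    gives |x_k - c| at most half the spread of X. *)
Lemma spread_le X : (0 < n)%N -> 0 <= M -> X ^t* = X ->
  lambda_min X <= lambda_max X ->
  lambda_max (Phi X) - lambda_min (Phi X)
    <= M / 2 * (lambda_max X - lambda_min X).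
Proof.
move=> n0 M0 hX leX.
have [U [d [hU eP]]] := spectral_theorem (Phi_herm hX).
pose i0 := Ordinal n0.
have [i _ hi] := arg_maxP d (isT : xpredT i0).
have [j _ hj] := arg_minP d (isT : xpredT i0).
have eM : lambda_max (Phi X) = expval (Phi X) (col i U).
  by rewrite eP (lambda_max_spectral hU (fun k => hi k isT)) expval_spectral_col.
have em : lambda_min (Phi X) = expval (Phi X) (col j U).
  by rewrite eP (lambda_min_spectral hU (fun k => hj k isT)) expval_spectral_col.
(* The two indices coincide only if Phi(X) is scalar. *)
have [ij|ij] := eqVneq i j.
  by rewrite eM em ij subrr mulr_ge0 ?divr_ge0 ?subr_ge0.
rewrite eM em.
have huv := orthonormal_cols hU ij.
move: (col i U) (col j U) huv => u v huv {eM em}.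
set A := Psi (ketbra u - ketbra v).
have -> : expval (Phi X) u - expval (Phi X) v = rtr (X *m A).
  by rewrite !expvalE -rtrB -mulmxBr adjointP.
have hA : A ^t* = A by exact/Psi_herm/pure_diff_herm.
apply: (@le_trans _ _ (trace_norm A / 2 * (lambda_max X - lambda_min X)));
  last first.
  apply: ler_wpM2r; first by rewrite subr_ge0.
  by apply: ler_wpM2r; [rewrite invr_ge0|exact: hM].
have trA : rtr A = 0.
  by case: huv => _ hu hv; rewrite rtr_Psi rtrB !rtr_ketbra_unit // subrr.
have [W [a [hW eA]]] := spectral_theorem hA.
rewrite eA trace_norm_spectral //; rewrite eA rtr_spectral // in trA.
pose c := (lambda_max X + lambda_min X) / 2.
have -> : rtr (X *m spectral_sum W a)
    = \sum_k a k * (expval X (col k W) - c).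
  under [RHS]eq_bigr do rewrite mulrBr.
  rewrite sumrB -mulr_suml trA mul0r subr0.
  rewrite rtr_mulC mulmx_suml rtr_sum; apply: eq_bigr => k _.
  by rewrite -scalemxAl rtrZ rtr_mulC -expvalE.
rewrite -mulrA mulr_suml; apply: ler_sum => k _.
apply: le_trans (ler_norm _) _; rewrite normrM ler_wpM2l //.
have := expval_lambda hX (u := col k W).
rewrite col_unitary // eqxx => /(_ erefl).
by rewrite ler_norml /c; lra.
Qed.

End Bound.

(** X is the sign of A = Psi(P(u) - P(v)): then tr(X A) = T(A), and
    tr(X A) = u^* Phi(X) u - v^* Phi(X) v is at most the spread of Phi(X). *)
Lemma spread_ge u v : (2 <= n)%N -> orthonormal_pair u v ->
  exists X, [/\ X ^t* = X, lambda_max X = 1, lambda_min X = -1 &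
    pure_distance u v <= lambda_max (Phi X) - lambda_min (Phi X)].
Proof.
move=> hn [_ hu hv]; rewrite /pure_distance; set A := Psi _.
have hA : A ^t* = A by exact/Psi_herm/pure_diff_herm.
have [W [a [hW eA]]] := spectral_theorem hA.
have trA : \sum_k a k = 0.
  rewrite -(rtr_spectral a hW) -eA rtr_Psi rtrB !rtr_ketbra_unit //.
  by rewrite subrr.
have [s [sb sa [i si] [j sj]]] := sign_vector hn trA.
have hX := spectral_sum_herm W s.
exists (spectral_sum W s); split=> //.
- rewrite -si; apply: lambda_max_spectral => // k.
  by have /andP[] := sb k; rewrite si.
- rewrite -sj; apply: lambda_min_spectral => // k.
  by have /andP[] := sb k; rewrite sj.
have -> : trace_norm A = rtr (spectral_sum W s *m A).
  rewrite eA trace_norm_spectral // mulmx_suml rtr_sum.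
  apply: eq_bigr => k _.
  by rewrite -scalemxAl rtrZ rtr_mulC -expvalE expval_spectral_col.
rewrite -adjointP mulmxBr rtrB -!expvalE.
have := expval_lambda (Phi_herm hX) hu.
have := expval_lambda (Phi_herm hX) hv.
lra.
Qed.

End AdjointPair.

(** * Compactness of sets of complex matrices *)

Section Continuity.
Variables (R : realType) (T : topologicalType).
Local Notation C := R[i].

(** Continuity of complex-valued maps is tested on real coordinates, for which
    compactness of cubes is available. *)
Definition complex_continuous (f : T -> C) :=
  continuous (fun w => complex.Re (f w)) /\
  continuous (fun w => complex.Im (f w)).

Definition mx_continuous p q (A : T -> 'M[C]_(p, q)) :=
  forall i j, complex_continuous (fun w => A w i j).

Lemma continuous_sumr (I : finType) (f : I -> T -> R) :
  (forall i, continuous (f i)) -> continuous (fun w => \sum_i f i w).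
Proof.
by move=> hf; apply: (continuous_big (op := +%R)) => //; exact: add_continuous.
Qed.

Lemma eq_complex_continuous (f g : T -> C) :
  f =1 g -> complex_continuous f -> complex_continuous g.
Proof. by move=> /funext ->. Qed.

Lemma complex_continuous_cst c : complex_continuous (fun=> c).
Proof. by split=> w; exact: cvg_cst. Qed.

Lemma complex_continuousD f g : complex_continuous f -> complex_continuous g ->
  complex_continuous (fun w => f w + g w).
Proof.
move=> [f1 f2] [g1 g2].
apply: (@eq_complex_continuous (fun w =>
  (complex.Re (f w) + complex.Re (g w)) +i* (complex.Im (f w) + complex.Im (g w)))).
  by move=> w; case: (f w) (g w) => [? ?] [? ?].
split=> w; apply: cvgD; [exact: f1|exact: g1|exact: f2|exact: g2].
Qed.

Lemma complex_continuousM f g : complex_continuous f -> complex_continuous g ->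
  complex_continuous (fun w => f w * g w).
Proof.
move=> [f1 f2] [g1 g2].
apply: (@eq_complex_continuous (fun w =>
  (complex.Re (f w) * complex.Re (g w) - complex.Im (f w) * complex.Im (g w))
  +i* (complex.Re (f w) * complex.Im (g w) + complex.Im (f w) * complex.Re (g w)))).
  by move=> w; case: (f w) (g w) => [? ?] [? ?].
split=> w /=; [apply: cvgB|apply: cvgD]; apply: cvgM;
  by [exact: f1|exact: g1|exact: f2|exact: g2].
Qed.

Lemma complex_continuousJ f : complex_continuous f ->
  complex_continuous (fun w => Num.conj (f w)).
Proof.
move=> [f1 f2].
apply: (@eq_complex_continuous (fun w => complex.Re (f w) -i* complex.Im (f w))).
  by move=> w; case: (f w).
by split=> w; [exact: f1|apply: cvgN; exact: f2].
Qed.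

Lemma complex_continuous_sum (I : finType) (f : I -> T -> C) :
  (forall i, complex_continuous (f i)) ->
  complex_continuous (fun w => \sum_i f i w).
Proof.
move=> hf; elim: (index_enum I) => [|i s IH].
  apply: eq_complex_continuous (complex_continuous_cst 0) => w.
  by rewrite big_nil.
apply: eq_complex_continuous (complex_continuousD (hf i) IH) => w.
by rewrite big_cons.
Qed.

Lemma mx_continuousM p q r (A : T -> 'M[C]_(p, q)) (B : T -> 'M[C]_(q, r)) :
  mx_continuous A -> mx_continuous B -> mx_continuous (fun w => A w *m B w).
Proof.
move=> hA hB i j.
apply: (@eq_complex_continuous (fun w => \sum_k A w i k * B w k j)).
  by move=> w; rewrite mxE.
by apply: complex_continuous_sum => k; exact: complex_continuousM.
Qed.

Lemma mx_continuousD p q (A B : T -> 'M[C]_(p, q)) :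
  mx_continuous A -> mx_continuous B -> mx_continuous (fun w => A w + B w).
Proof.
move=> hA hB i j.
apply: (@eq_complex_continuous (fun w => A w i j + B w i j)).
  by move=> w; rewrite mxE.
exact: complex_continuousD.
Qed.

Lemma mx_continuousN p q (A : T -> 'M[C]_(p, q)) :
  mx_continuous A -> mx_continuous (fun w => - A w).
Proof.
move=> hA i j.
apply: (@eq_complex_continuous (fun w => (-1) * A w i j)).
  by move=> w; rewrite mxE mulN1r.
by apply: complex_continuousM => //; exact: complex_continuous_cst.
Qed.

Lemma mx_continuous_trC p q (A : T -> 'M[C]_(p, q)) :
  mx_continuous A -> mx_continuous (fun w => (A w) ^t*).
Proof.
move=> hA i j.
apply: (@eq_complex_continuous (fun w => Num.conj (A w j i))).
  by move=> w; rewrite !mxE.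
exact: complex_continuousJ.
Qed.

Lemma mx_continuous_cst p q (A : 'M[C]_(p, q)) : mx_continuous (fun=> A).
Proof. by move=> i j; exact: complex_continuous_cst. Qed.

Lemma mx_continuous_sum p q (I : finType) (A : I -> T -> 'M[C]_(p, q)) :
  (forall k, mx_continuous (A k)) -> mx_continuous (fun w => \sum_k A k w).
Proof.
move=> hA i j.
apply: (@eq_complex_continuous (fun w => \sum_k A k w i j)).
  by move=> w; rewrite summxE.
by apply: complex_continuous_sum => k; exact: hA.
Qed.

Lemma mx_continuous_colsub p q r (f : 'I_r -> 'I_q) (A : T -> 'M[C]_(p, q)) :
  mx_continuous A -> mx_continuous (fun w => colsub f (A w)).
Proof.
move=> hA i j; apply: eq_complex_continuous (hA i (f j)) => w.
by rewrite mxE.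
Qed.

Lemma eq_mx_continuous p q (A B : T -> 'M[C]_(p, q)) :
  A =1 B -> mx_continuous A -> mx_continuous B.
Proof. by move=> /funext ->. Qed.

Lemma closed_mx_eq p q (A : T -> 'M[C]_(p, q)) (B : 'M[C]_(p, q)) :
  mx_continuous A -> closed [set w | A w = B].
Proof.
move=> hA.
have -> : [set w | A w = B] = \bigcap_(ij in @setT ('I_p * 'I_q))
   ((fun w => complex.Re (A w ij.1 ij.2)) @^-1` [set x | x = complex.Re (B ij.1 ij.2)]
   `&` (fun w => complex.Im (A w ij.1 ij.2)) @^-1` [set x | x = complex.Im (B ij.1 ij.2)]).
  apply/seteqP; split=> [w /= AB [i j] _ /=|w /= h]; first by rewrite AB.
  apply/matrixP => i j; have [/=] := h (i, j) I.
  by case: (A w i j) (B i j) => [? ?] [? ?] /= -> ->.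
apply: closed_bigI => -[i j] _ /=; have [h1 h2] := hA i j.
by apply: closedI; apply: preimage_closed; rewrite //; exact: closed_eq.
Qed.

Lemma continuous_qform n (A : T -> 'M[C]_n) (x : T -> 'cV[C]_n) :
  mx_continuous A -> mx_continuous x -> continuous (fun w => qform (A w) (x w)).
Proof.
move=> hA hx.
by have [] := mx_continuousM (mx_continuousM (mx_continuous_trC hx) hA) hx 0 0.
Qed.

End Continuity.

Section Cube.
Import ArrowAsProduct.
Variables (R : realType) (I : eqType).

Lemma coordinate_continuous (k : I) : continuous (fun w : I -> R => w k).
Proof. exact: (@proj_continuous I (fun=> R) k). Qed.

Lemma cube_compact :
  compact [set w : I -> R | forall k, `[(-1 : R), 1]%classic (w k)].
Proof.
exact: (@tychonoff I (fun=> R) (fun=> `[(-1 : R), 1]%classic)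
  (fun=> @segment_compact R (-1) 1)).
Qed.

End Cube.

Section MatrixEVT.
Variables (R : realType) (p q : nat).
Local Notation C := R[i].
Import ArrowAsProduct.
Local Notation coords := (forall _ : 'I_p * 'I_q * bool, R).

(** The boolean selects the imaginary part. *)
Definition mx_of_coords (w : coords) : 'M[C]_(p, q) :=
  \matrix_(i, j) (w (i, j, false) +i* w (i, j, true)).

Lemma mx_of_coords_continuous : mx_continuous mx_of_coords.
Proof.
move=> i j; apply: (@eq_complex_continuous _ _
  (fun w : coords => w (i, j, false) +i* w (i, j, true))).
  by move=> w; rewrite mxE.
by split=> /=; exact: (@coordinate_continuous R ('I_p * 'I_q * bool)%type).
Qed.

(** The extreme value theorem, transported to the coordinate cube, which is compact
    by Tychonoff's theorem. *)
Lemma matrix_EVT_max (K : set 'M[C]_(p, q)) (f : 'M[C]_(p, q) -> R) :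
  K !=set0 ->
  (forall Z i j, K Z -> `|complex.Re (Z i j)| <= 1 /\ `|complex.Im (Z i j)| <= 1) ->
  closed [set w | K (mx_of_coords w)] ->
  continuous (f \o mx_of_coords) ->
  exists2 Z, K Z & forall Z', K Z' -> f Z' <= f Z.
Proof.
move=> [Z0 KZ0] Kb Kc fc.
pose coord (Z : 'M[C]_(p, q)) : coords :=
  fun k => if k.2 then complex.Im (Z k.1.1 k.1.2) else complex.Re (Z k.1.1 k.1.2).
have coordK Z : mx_of_coords (coord Z) = Z.
  by apply/matrixP => i j; rewrite mxE /coord /=; case: (Z i j).
have cube := @cube_compact R ('I_p * 'I_q * bool)%type.
have Kcompact : compact [set w | K (mx_of_coords w)].
  apply: subclosed_compact Kc cube _ => w /= Kw [[i j] b].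
  have := Kb _ i j Kw; rewrite !mxE /= !ler_norml in_itv /= => -[h1 h2].
  by case: b.
have ne : [set w | K (mx_of_coords w)] !=set0.
  by exists (coord Z0); rewrite /= coordK.
have [w Kw hw] := compact_EVT_max ne Kcompact (continuous_subspaceT fc).
exists (mx_of_coords w); first by rewrite inE in Kw.
move=> Z' KZ'; rewrite -(coordK Z'); apply: hw.
by rewrite inE /= coordK.
Qed.

End MatrixEVT.

Lemma unit_entry_le1 (R : realType) n (u : 'cV[R[i]]_n) k : u ^t* *m u = 1%:M ->
  `|complex.Re (u k 0)| <= 1 /\ `|complex.Im (u k 0)| <= 1.
Proof.
move=> /matrixP /(_ 0 0); rewrite mxE => /(congr1 (@complex.Re R)).
rewrite Re_sum [in RHS]mxE eqxx /=.
have E l : complex.Re ((u ^t*) 0 l * u l 0)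
    = complex.Re (u l 0) ^+ 2 + complex.Im (u l 0) ^+ 2.
  by rewrite !mxE; case: (u l 0) => a b /=; ring.
rewrite (eq_bigr _ (fun l _ => E l)) (bigD1 k) //=.
set s := \sum_(i | _) _ => h.
have s0 : 0 <= s by apply: sumr_ge0 => l _; rewrite addr_ge0 ?sqr_ge0.
move: h s0 => {E}; move: s (complex.Re _) (complex.Im _) => s a b h s0.
have a2 := sqr_ge0 a; have b2 := sqr_ge0 b.
by split; rewrite -(@expr_le1 _ 2) // real_normK ?num_real //; lra.
Qed.

(** * Kraus maps *)

Section Kraus.
Import ArrowAsProduct.
Variables (R : realType) (n m : nat) (V : 'I_m -> 'M[R[i]]_n).
Local Notation C := R[i].
Local Notation Phi := (kraus_unital V).
Local Notation Psi := (kraus_dual V).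

Lemma kraus_dual_is_linear : linear Psi.
Proof.
move=> a A B; rewrite /kraus_dual scaler_sumr -big_split /=.
by apply: eq_bigr => i _; rewrite mulmxDr mulmxDl -scalemxAr -scalemxAl.
Qed.

HB.instance Definition _ :=
  GRing.isLinear.Build C 'M[C]_n 'M[C]_n *:%R Psi kraus_dual_is_linear.

Lemma kraus_unital_herm X : X ^t* = X -> (Phi X) ^t* = Phi X.
Proof.
move=> hX; rewrite trmxC_sum; apply: eq_bigr => i _.
by rewrite !trmxC_mul trmxCK hX mulmxA.
Qed.

Lemma kraus_dual_herm X : X ^t* = X -> (Psi X) ^t* = Psi X.
Proof.
move=> hX; rewrite trmxC_sum; apply: eq_bigr => i _.
by rewrite !trmxC_mul trmxCK hX mulmxA.
Qed.

Lemma kraus_duality X A : rtr (Phi X *m A) = rtr (X *m Psi A).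
Proof.
rewrite mulmx_suml mulmx_sumr !rtr_sum; apply: eq_bigr => i _.
by rewrite -!mulmxA rtr_mulC -!mulmxA.
Qed.

Lemma kraus_unital1 :
  \sum_(i < m) (V i) ^t* *m V i = 1%:M -> Phi 1%:M = 1%:M.
Proof. by move=> hV; rewrite -[RHS]hV; apply: eq_bigr => i _; rewrite mulmx1. Qed.

Lemma kraus_dual_continuous (T : topologicalType) (A : T -> 'M[C]_n) :
  mx_continuous A -> mx_continuous (fun w => Psi (A w)).
Proof.
move=> hA; apply: mx_continuous_sum => k.
apply: mx_continuousM (mx_continuous_cst _ _).
exact: mx_continuousM (mx_continuous_cst _ _) hA.
Qed.

Lemma continuous_sum_abs_qform (T : topologicalType)
    (u v : T -> 'cV[C]_n) (X : T -> 'M[C]_n) :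
  mx_continuous u -> mx_continuous v -> mx_continuous X ->
  continuous (fun w => \sum_i
    `|qform (Psi (u w *m (u w) ^t* - v w *m (v w) ^t*)) (col i (X w))|).
Proof.
move=> hu hv hX.
have hP : mx_continuous (fun w => Psi (u w *m (u w) ^t* - v w *m (v w) ^t*)).
  apply: kraus_dual_continuous; apply: mx_continuousD.
    by apply: mx_continuousM => //; exact: mx_continuous_trC.
  apply: mx_continuousN; apply: mx_continuousM => //.
  exact: mx_continuous_trC.
have hc i : mx_continuous (fun w => col i (X w)).
  apply: eq_mx_continuous (mx_continuous_colsub (fun=> i) hX) => w.
  by apply/matrixP => k l; rewrite !mxE.
have hq i := continuous_qform hP (hc i).
apply: (@continuous_sumr R T 'I_n (fun i w =>
  `|qform (Psi (u w *m (u w) ^t* - v w *m (v w) ^t*)) (col i (X w))|)) => i w.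
apply: cvg_norm; exact: hq.
Qed.

(** The triple (u, v, X) is stored as the single matrix (u | v | X), on which the
    constraints are polynomial equations that bound every entry by 1.  The function
    maximized is \sum_i |x_i^* Psi(P(u) - P(v)) x_i|, whose maximum over X is the
    trace norm: this replaces a proof that the trace norm is continuous. *)
Lemma pure_distance_max : (2 <= n)%N ->
  exists u v : 'cV[C]_n, orthonormal_pair u v /\
    forall u' v', orthonormal_pair u' v' ->
      pure_distance Psi u' v' <= pure_distance Psi u v.
Proof.
move=> hn.
pose U (Z : 'M[C]_(n, 1 + (1 + n))) := lsubmx Z.
pose W (Z : 'M[C]_(n, 1 + (1 + n))) := lsubmx (rsubmx Z).
pose X (Z : 'M[C]_(n, 1 + (1 + n))) := rsubmx (rsubmx Z).
pose K := [set Z | orthonormal_pair (U Z) (W Z) /\ X Z \is unitarymx].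
pose f (Z : 'M[C]_(n, 1 + (1 + n))) : R :=
  \sum_i `|qform (Psi (U Z *m (U Z) ^t* - W Z *m (W Z) ^t*)) (col i (X Z))|.
have fE Z : f Z =
    \sum_i `|expval (Psi (ketbra (U Z) - ketbra (W Z))) (col i (X Z))|.
  by apply: eq_bigr => i _; rewrite expval_qform !ketbraE.
have UE u v x : U (row_mx u (row_mx v x)) = u by rewrite /U row_mxKl.
have WE u v x : W (row_mx u (row_mx v x)) = v by rewrite /W row_mxKr row_mxKl.
have XE u v x : X (row_mx u (row_mx v x)) = x by rewrite /X !row_mxKr.
have K0 : K !=set0.
  have h1 : (1%:M : 'M[C]_n) \is unitarymx.
    by apply/unitarymxP; rewrite trmx1 map_mx1 mulmx1.
  exists (row_mx (col (Ordinal (ltnW hn)) 1%:M)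
                 (row_mx (col (Ordinal hn) 1%:M) 1%:M)).
  by split; rewrite ?UE ?WE ?XE //; exact: orthonormal_cols.
have Kb Z i j : K Z -> `|complex.Re (Z i j)| <= 1 /\ `|complex.Im (Z i j)| <= 1.
  move=> [[_ hu hv] hX].
  have cols k : (col k (X Z)) ^t* *m col k (X Z) = 1%:M.
    by rewrite col_unitary // eqxx.
  case: (split_ordP j) => [k ->|k ->].
    have -> : Z i (lshift _ k) = U Z i 0 by rewrite mxE (ord1 k).
    exact: unit_entry_le1.
  case: (split_ordP k) => [l ->|l ->].
    have -> : Z i (rshift 1 (lshift n l)) = W Z i 0 by rewrite !mxE (ord1 l).
    exact: unit_entry_le1.
  have -> : Z i (rshift 1 (rshift 1 l)) = col l (X Z) i 0 by rewrite !mxE.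
  exact: unit_entry_le1.
pose coords := 'I_n * 'I_(1 + (1 + n)) * bool -> R.
have mxc : mx_continuous (fun w : coords => mx_of_coords w).
  exact: mx_of_coords_continuous.
have cU : mx_continuous (fun w : coords => U (mx_of_coords w)).
  apply: eq_mx_continuous (mx_continuous_colsub (@lshift 1 (1 + n)) mxc) => w.
  by apply/matrixP => i j; rewrite !mxE.
have cR : mx_continuous (fun w : coords => rsubmx (mx_of_coords w)).
  apply: eq_mx_continuous (mx_continuous_colsub (@rshift 1 (1 + n)) mxc) => w.
  by apply/matrixP => i j; rewrite !mxE.
have cW : mx_continuous (fun w : coords => W (mx_of_coords w)).
  apply: eq_mx_continuous (mx_continuous_colsub (@lshift 1 n) cR) => w.
  by apply/matrixP => i j; rewrite !mxE.
have cX : mx_continuous (fun w : coords => X (mx_of_coords w)).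
  apply: eq_mx_continuous (mx_continuous_colsub (@rshift 1 n) cR) => w.
  by apply/matrixP => i j; rewrite !mxE.
have Kc : closed [set w : coords | K (mx_of_coords w)].
  have -> : [set w : coords | K (mx_of_coords w)] =
    [set w : coords | (U (mx_of_coords w)) ^t* *m W (mx_of_coords w) = 0]
    `&` [set w : coords | (U (mx_of_coords w)) ^t* *m U (mx_of_coords w) = 1%:M]
    `&` [set w : coords | (W (mx_of_coords w)) ^t* *m W (mx_of_coords w) = 1%:M]
    `&` [set w : coords | X (mx_of_coords w) *m (X (mx_of_coords w)) ^t* = 1%:M].
    apply/seteqP; split=> w /=.
      by move=> [[h1 h2 h3] /unitarymxP h4].
    by move=> [[[h1 h2] h3] h4]; split; [split|apply/unitarymxP].
  by apply: closedI; [apply: closedI; [apply: closedI|]|];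
    apply: closed_mx_eq; apply: mx_continuousM => //; exact: mx_continuous_trC.
have fc : continuous (fun w : coords => f (mx_of_coords w)).
  exact: (continuous_sum_abs_qform cU cW cX).
have [Z [hZ hX] hmax] := matrix_EVT_max K0 Kb Kc fc.
have herm u v : (Psi (ketbra u - ketbra v)) ^t* = Psi (ketbra u - ketbra v).
  exact/kraus_dual_herm/pure_diff_herm.
exists (U Z), (W Z); split; first exact: hZ.
move=> u v huv.
have [X' hX' eX'] := pinching_eq (herm u v).
have KX' : K (row_mx u (row_mx v X')) by split; rewrite ?UE ?WE ?XE.
have := hmax _ KX'.
rewrite (fE (row_mx _ _)) UE WE XE (fE Z) eX' => h.
exact: le_trans h (pinching (herm (U Z) (W Z)) hX).
Qed.

Hypothesis hn : (2 <= n)%N.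
Hypothesis hV : \sum_(i < m) (V i) ^t* *m V i = 1%:M.
Variables u v : 'cV[C]_n.
Hypothesis huv : orthonormal_pair u v.
Hypothesis huv_max : forall u' v', orthonormal_pair u' v' ->
  pure_distance Psi u' v' <= pure_distance Psi u v.

(** A pair of density matrices is reduced to its difference; orthogonal pure states
    have a difference of trace norm at most 2, which bounds their ratio from below. *)
Lemma trace_contraction_kraus :
  trace_contraction Psi = (pure_distance Psi u v / 2)%:E.
Proof.
apply/le_anti/andP; split.
  apply: ge_ereal_sup => _ [[r1 r2] /= [[[h1 _] t1] [[h2 _] t2] r12] <-].
  move: h1 h2 => /hermsymP h1 /hermsymP h2.
  rewrite lee_fin -(linearB Psi).
  have hD : (r1 - r2) ^t* = r1 - r2 by rewrite trmxC_sub h1 h2.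
  have D0 : r1 - r2 <> 0 by move=> /eqP; rewrite subr_eq0 => /eqP.
  rewrite ler_pdivrMr ?trace_norm_gt0 //.
  apply: (trace_norm_adjoint_le kraus_dual_herm huv_max) => //.
  by rewrite rtrB !rtr.unlock t1 t2 subrr.
have hdens w : w ^t* *m w = 1%:M -> density_matrix (ketbra w).
  move=> hw; split; last first.
    by rewrite ketbraE mxtrace_mulC hw mxtrace1.
  by split; [apply/hermsymP; exact: ketbra_herm|move=> x; exact: ketbra_form_ge0].
have [_ hu hv] := huv.
have D0 := pure_diff_neq0 huv.
apply: le_trans (ereal_sup_ubound _); last first.
  by exists (ketbra u, ketbra v) => //=; split=> //; exact: hdens.
rewrite lee_fin /= -(linearB Psi) -/(pure_distance Psi u v).
apply: ler_wpM2l; first exact: pure_distance_ge0.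
rewrite lef_pV2 ?posrE ?trace_norm_pure_diff_le2 //.
apply: trace_norm_gt0; first exact: pure_diff_herm.
by move=> /eqP; rewrite subr_eq0 => /eqP.
Qed.

Lemma hopf_norm_kraus : hopf_norm Phi = (pure_distance Psi u v / 2)%:E.
Proof.
have adj := kraus_duality.
have Phi1 := kraus_unital1 hV.
have [_ hu hv] := huv.
apply/le_anti/andP; split.
  apply: ge_ereal_sup => _ [X /= [/hermsymP hX ne] <-].
  have leX : lambda_min X <= lambda_max X.
    by have /andP[h1 h2] := expval_lambda hX hu; exact: le_trans h2.
  rewrite lee_fin ler_pdivrMr; last first.
    by rewrite subr_gt0 lt_neqAle leX andbT; apply/eqP => h; exact: ne.
  apply: (spread_le adj Phi1 kraus_unital_herm kraus_dual_herm huv_max) => //.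
    exact: ltnW.
  exact: pure_distance_ge0.
have [X [hX eM em le]] :=
  spread_ge adj Phi1 kraus_unital_herm kraus_dual_herm hn huv.
apply: le_trans (ereal_sup_ubound _); last first.
  exists X => //=; split; first exact/hermsymP.
  by rewrite eM em; apply/eqP; rewrite gt_eqF // -subr_gt0 opprK addr_gt0.
by rewrite lee_fin eM em (opprK (1 : R)) -[1 + 1]mulr2n ler_pM2r ?invr_gt0.
Qed.

End Kraus.

(* g u v is the inner minimum and mu the outer one; both are attained. *)
Theorem corollary4p6 (R : realType) (n m : nat) (V : 'I_m -> 'M[R[i]]_n)
    (hn : (2 <= n)%N)
    (hV : \sum_(i < m) (V i) ^t* *m V i = 1%:M) :
  exists (g : 'cV[R[i]]_n -> 'cV[R[i]]_n -> R) (mu : R),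
    [/\ forall u v : 'cV[R[i]]_n, orthonormal_pair u v ->
          is_minimum [set overlap (kraus_unital V) u v X
                     | X in [set X : 'M[R[i]]_n | X \is unitarymx]] (g u v),
        is_minimum [set g p.1 p.2
                   | p in [set p : 'cV[R[i]]_n * 'cV[R[i]]_n |
                             orthonormal_pair p.1 p.2]] mu,
        hopf_norm (kraus_unital V) = trace_contraction (kraus_dual V)
      & trace_contraction (kraus_dual V) = (1 - mu)%:E].
Proof.
have [u [v [huv hmax]]] := pure_distance_max V hn.
pose g a b := 1 - pure_distance (kraus_dual V) a b / 2.
exists g, (g u v); split.
- move=> a b hab.
  exact: (overlap_minimum (kraus_duality V) (kraus_unital1 hV)
    (@kraus_dual_herm _ _ _ V) hab).
- split; first by exists (u, v).
  have h2 : 0 <= (2^-1 : R) by rewrite invr_ge0.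
  move=> _ [[a b] /= hab <-].
  exact: lerB (lexx 1) (ler_wpM2r h2 (hmax a b hab)).
- by rewrite (hopf_norm_kraus hn hV huv hmax) (trace_contraction_kraus huv hmax).
by rewrite (trace_contraction_kraus huv hmax) /g subKr.
Qed.
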